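(* Let $M$ be a finite simple connected graph whose path matrix has exactly one positive eigenvalue (counted with multiplicity). Then this positive path eigenvalue is the path spectral radius $\rho$ of $M$, and the path energy of $M$ is $PE(M)=2\rho$.
   Context: For a finite simple graph $M$ with vertex set $\{v_1,\dots,v_p\}$, the path matrix $P(M)=(p_{i,j})$ is the $p\times p$ real symmetric matrix with $p_{i,i}=0$ and, for $i\neq j$, $p_{i,j}$ equal to the maximum number of vertex disjoint paths from $v_i$ to $v_j$ (i.e. paths that pairwise share no vertices other than the endpoints $v_i,v_j$; an edge $v_iv_j$ counts as one such path). The path eigenvalues of $M$ are the eigenvalues of $P(M)$; the path spectral radius $\rho$ is the maximum of the absolute values of the path eigenvalues; and the path energy $PE(M)$ is the sum of the absolute values of the path eigenvalues, counted with multiplicity. *)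

(* Defs.v *)
From mathcomp Require Import all_boot all_order all_algebra.
From mathcomp Require Import polyrcf.

Set Implicit Arguments.
Unset Strict Implicit.
Unset Printing Implicit Defensive.

Import Order.TTheory GRing.Theory Num.Theory.
Local Open Scope ring_scope.

(* A finite simple graph is a symmetric irreflexive relation e on a finType. *)

Section VertexDisjointPaths.
Variables (T : finType) (e : rel T).

Definition connected_graph : Prop := forall x y : T, connect e x y.

(* As in path.v, the path is u :: p: the sequence p omits the start u. *)
Definition is_path_between (u v : T) (p : seq T) : bool :=
  [&& path e u p, last u p == v & uniq (u :: p)].

Definition internally_disjoint (u v : T) (p q : seq T) : bool :=
  [forall x : T, (x \in u :: p) && (x \in u :: q) ==> (x == u) || (x == v)].

(* Paths do not repeat vertices, so sequences of length at most #|T| suffice. *)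
Definition vertex_disjoint_paths (u v : T) (F : {set {bseq #|T| of T}}) : bool :=
  [forall p in F, is_path_between u v p] &&
  [forall p in F, forall q in F, (p != q) ==> internally_disjoint u v p q].

(* The family is a set, so the edge uv, i.e. p = [:: v], counts once. *)
Definition max_disjoint_paths (u v : T) : nat :=
  \max_(F : {set {bseq #|T| of T}} | vertex_disjoint_paths u v F) #|F|.

Definition path_matrix (R : nzRingType) : 'M[R]_#|T| :=
  \matrix_(i, j) if i == j then 0
                 else (max_disjoint_paths (enum_val i) (enum_val j))%:R.

End VertexDisjointPaths.

Section PathSpectrum.
Variable R : rcfType.

(* The eigenvalues in R, repeated according to their multiplicity as roots of
   the characteristic polynomial.  For a symmetric matrix these are all the
   eigenvalues. *)
Definition eigenvalues n (A : 'M[R]_n) : seq R :=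
  flatten [seq nseq (mup x (char_poly A)) x | x <- rootsR (char_poly A)].

Variables (T : finType) (e : rel T).

Definition path_eigenvalues : seq R := eigenvalues (path_matrix e R).

Definition path_spectral_radius : R :=
  \big[Num.max/0]_(x <- path_eigenvalues) `|x|.

Definition path_energy : R := \sum_(x <- path_eigenvalues) `|x|.

End PathSpectrum.

(* Main.v *)
(** The path matrix is symmetric, because reversing paths is a bijection between
    the disjoint families from [u] to [v] and those from [v] to [u].  Hence its
    characteristic polynomial splits over [R], and its eigenvalues sum to its
    trace, which is 0.  The only positive eigenvalue therefore balances all the
    others: it is the sum of their absolute values, so it dominates each of them
    and is half of the energy. *)
Require Import Defs.
From mathcomp Require Import all_boot all_order all_algebra.
From mathcomp Require Import polyrcf complex spectral.

Set Implicit Arguments.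
Unset Strict Implicit.
Unset Printing Implicit Defensive.

Import Order.TTheory GRing.Theory Num.Theory.
Local Open Scope ring_scope.

(** A path is stored without its start, so reversing it must drop [v] and append [u], hence
    [belast]. The second conjunct says that the full vertex sequence is merely reversed. *)
Lemma rev_belast_path (T : finType) (e : rel T) (e_sym : symmetric e)
    (u v : T) (p : seq T) :
  is_path_between e u v p ->
  is_path_between e v u (rev (belast u p)) /\
  v :: rev (belast u p) = rev (u :: p).
Proof.
case/and3P=> pp /eqP lp up.
have eq_rev : v :: rev (belast u p) = rev (u :: p).
  by rewrite [in RHS]lastI lp rev_rcons.
split=> //; apply/and3P; split.
- by rewrite -lp rev_path (eq_path (e' := e)) // => x y /=; rewrite e_sym.
- have -> : last v (rev (belast u p)) = last v (v :: rev (belast u p)) by [].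
  by rewrite eq_rev rev_cons last_rcons.
- by rewrite eq_rev rev_uniq.
Qed.

(** Reversal maps a disjoint family injectively to one in the other direction; equality follows by
    exchanging [u] and [v]. *)
Lemma max_disjoint_paths_leq (T : finType) (e : rel T) (e_sym : symmetric e)
    (u v : T) :
  (max_disjoint_paths e u v <= max_disjoint_paths e v u)%N.
Proof.
apply/bigmax_leqP=> F /andP[/forall_inP Fpath /forall_inP Fdisj].
pose r (p : {bseq #|T| of T}) : {bseq #|T| of T} := [bseq of rev (belast u p)].
have rE p : p \in F -> v :: r p = rev (u :: p).
  by move=> /Fpath pP; case: (rev_belast_path e_sym pP).
have r_inj : {in F &, injective r}.
  move=> p q pF qF eq_r; apply/val_inj.
  have := rE p pF; rewrite eq_r (rE q qF) => /(can_inj revK).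
  by case.
rewrite -(card_in_imset r_inj).
apply: (leq_bigmax_cond (F := fun G : {set {bseq #|T| of T}} => #|G|)).
apply/andP; split; apply/forall_inP=> _ /imsetP[p pF ->].
  by case: (rev_belast_path e_sym (Fpath _ pF)).
apply/forall_inP=> _ /imsetP[q qF ->]; apply/implyP=> neq_r.
have neq_pq : p != q by apply: contraNneq neq_r => ->.
apply/forallP=> x; rewrite !rE // !mem_rev orbC.
by have /forall_inP/(_ _ qF)/implyP/(_ neq_pq)/forallP := Fdisj _ pF; apply.
Qed.

Lemma max_disjoint_paths_sym (T : finType) (e : rel T) (e_sym : symmetric e)
    (u v : T) :
  max_disjoint_paths e u v = max_disjoint_paths e v u.
Proof. by apply/eqP; rewrite eqn_leq !max_disjoint_paths_leq. Qed.

Lemma path_matrix_sym (R : nzRingType) (T : finType) (e : rel T)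
    (e_sym : symmetric e) :
  (path_matrix e R)^T = path_matrix e R.
Proof.
by apply/matrixP=> i j; rewrite !mxE eq_sym max_disjoint_paths_sym.
Qed.

Lemma path_matrix_trace (R : nzRingType) (T : finType) (e : rel T) :
  \tr (path_matrix e R) = 0.
Proof. by rewrite /mxtrace big1 // => i _; rewrite mxE eqxx. Qed.

Lemma char_poly_conj (R : comUnitRingType) n (P A B : 'M[R]_n) :
  P \in unitmx -> A = invmx P *m B *m P -> char_poly A = char_poly B.
Proof.
move=> Pu ->; rewrite /char_poly /char_poly_mx.
(* Scalar matrices commute with [P], so the characteristic matrices are conjugate too, and the
   determinants of [P] and its inverse cancel. *)
have -> : 'X%:M - map_mx polyC (invmx P *m B *m P) =
    map_mx polyC (invmx P) *m ('X%:M - map_mx polyC B) *m map_mx polyC P.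
  rewrite mulmxBr mulmxBl !map_mxM scalar_mxC -(mulmxA 'X%:M) -[X in _ *m X - _]map_mxM mulVmx //.
  by rewrite map_mx1 mulmx1.
rewrite !det_mulmx mulrC mulrA -det_mulmx -map_mxM mulmxV //.
by rewrite map_mx1 det1 mul1r.
Qed.

Lemma char_poly_diag (R : comNzRingType) n (d : 'rV[R]_n) :
  char_poly (diag_mx d) = \prod_(i < n) ('X - (d 0 i)%:P).
Proof.
rewrite char_poly_trig ?diag_mx_is_trig //.
by apply: eq_bigr => i _; rewrite mxE eqxx.
Qed.

(** Over [complex R] the matrix is Hermitian, so the spectral theorem diagonalises it with real
    diagonal entries. The resulting factorisation descends to [R] because the embedding is injective
    on polynomials. *)
Lemma symmetric_char_poly_split (R : rcfType) n (A : 'M[R]_n) :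
  A^T = A -> exists s : seq R, char_poly A = \prod_(x <- s) ('X - x%:P).
Proof.
move=> A_sym; pose toC : R -> complex R := real_complex R.
pose B : 'M[complex R]_n := map_mx toC A.
have B_herm : B \is hermsymmx.
  apply: realsym_hermsym.
    by apply/is_hermitianmxP; rewrite expr0 scale1r map_mx_id // map_trmx A_sym.
  by apply/mxOverP=> i j; rewrite mxE complex_real.
have /orthomx_spectralP B_eq := hermitian_normalmx B_herm.
have /mxOverP d_real := hermitian_spectral_diag_real B_herm.
exists [seq complex.Re (spectral_diag B 0 i) | i <- enum 'I_n].
apply: (map_poly_inj (real_complex R)).
rewrite map_char_poly (char_poly_conj (spectral_unit B) B_eq) char_poly_diag.
rewrite big_map big_enum rmorph_prod; apply: eq_bigr => i _ /=.
by rewrite rmorphB /= map_polyX map_polyC /= RRe_real.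
Qed.

Lemma perm_eigenvalues (R : rcfType) n (A : 'M[R]_n) (s : seq R) :
  char_poly A = \prod_(x <- s) ('X - x%:P) -> perm_eq (eigenvalues A) s.
Proof.
move=> chiE; apply: perm_trans (perm_count_undup s).
have -> : eigenvalues A =
    flatten [seq nseq (count_mem x s) x | x <- rootsR (char_poly A)].
  by rewrite /eigenvalues; congr flatten; apply: eq_map=> x; rewrite chiE mu_prod_XsubC.
(* Multiplicities already agree; it remains to match the distinct roots with [undup s]. *)
apply/perm_flatten/perm_map/uniq_perm; rewrite ?undup_uniq //.
  exact: uniq_roots.
move=> x; rewrite mem_undup -roots_on_rootsR ?monic_neq0 ?char_poly_monic //=.
by rewrite chiE root_prod_XsubC.
Qed.

(** Both sides are minus the subleading coefficient of the characteristic polynomial. *)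
Lemma symmetric_sum_eigenvalues (R : rcfType) n (A : 'M[R]_n) :
  A^T = A -> \sum_(x <- eigenvalues A) x = \tr A.
Proof.
move=> /symmetric_char_poly_split[s chiE].
rewrite (perm_big _ (perm_eigenvalues chiE)) /=.
have size_s : size s = n.
  by apply: succn_inj; rewrite -(size_char_poly A) chiE size_prod_XsubC.
(* In dimension 0 there is no subleading coefficient, but both sums are empty. *)
case: n A chiE size_s => [|n] A chiE size_s.
  by rewrite (size0nil size_s) big_nil /mxtrace big_ord0.
apply: oppr_inj; rewrite -char_poly_trace // chiE -coefPn_prod_XsubC size_s //.
Qed.

Lemma count_pos1_sum0 (R : realDomainType) (s : seq R) :
  count (fun x => 0 < x) s = 1%N -> \sum_(x <- s) x = 0 ->
  exists lam : R, [/\ forall x, x \in s -> 0 < x -> x = lam,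
    \big[Num.max/0]_(x <- s) `|x| = lam & \sum_(x <- s) `|x| = 2 * lam].
Proof.
move=> one_pos sum0.
have /hasP[lam lam_s lam_gt0] : has (fun x => 0 < x) s by rewrite has_count one_pos.
have perm_s := perm_to_rem lam_s; set t := rem lam s in perm_s.
have t_le0 x : x \in t -> x <= 0.
  have := one_pos; rewrite (permP perm_s) /= lam_gt0 add1n => -[] /eqP.
  by rewrite -leqn0 leqNgt -has_count => /hasPn H /H; rewrite -leNgt.
have sum_t : \sum_(x <- t) `|x| = lam.
  (* Since [t] has no positive entry, [lam] minus the sum of absolute values over [t] is the whole
     sum over [s], which vanishes. *)
  apply/eqP; rewrite -subr_eq0 -oppr_eq0 opprB -[X in _ == X]sum0.
  rewrite (perm_big _ perm_s) big_cons /= -sumrN; apply/eqP; congr (_ + _).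
  by apply: eq_big_seq => x /t_le0 x_le0; rewrite ler0_norm ?opprK.
have lam_max x : x \in s -> `|x| <= lam.
  rewrite (perm_mem perm_s) inE => /predU1P[->|x_t]; first by rewrite gtr0_norm.
  rewrite -sum_t (perm_big _ (perm_to_rem x_t)) big_cons lerDl.
  exact: sumr_ge0.
exists lam; split.
- move=> x; rewrite (perm_mem perm_s) inE => /predU1P[//|/t_le0 x_le0].
  by rewrite ltNge x_le0.
- apply/le_anti/andP; split.
    (* The initial value 0 of the maximum is also bounded by [lam], which is positive. *)
    rewrite big_seq; elim/big_ind: _ => [|x y x_le y_le|x]; last exact: lam_max.
      exact: ltW.
    by rewrite ge_max x_le.
  by rewrite (perm_big _ perm_s) big_cons /= le_max gtr0_norm ?lexx.
- by rewrite (perm_big _ perm_s) big_cons /= sum_t gtr0_norm // mulr2n mulrDl mul1r.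
Qed.

Theorem proposition1p7 (R : rcfType) (T : finType) (e : rel T)
    (e_sym : symmetric e) (e_irr : irreflexive e) (e_conn : connected_graph e)
    (one_pos : count (fun x : R => 0 < x) (path_eigenvalues R e) = 1%N) :
  (forall lam : R, lam \in path_eigenvalues R e -> 0 < lam ->
     lam = path_spectral_radius R e) /\
  path_energy R e = 2 * path_spectral_radius R e.
Proof.
have sum0 : \sum_(x <- path_eigenvalues R e) x = 0.
  by rewrite symmetric_sum_eigenvalues ?path_matrix_trace ?path_matrix_sym.
have [rho [uniq_pos radiusE energyE]] := count_pos1_sum0 one_pos sum0.
by rewrite /path_energy /path_spectral_radius radiusE energyE.
Qed.
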